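(* Let $X$ be a real-valued random variable with finite moments of all orders, let $H=\mathbb{R}[x]$ with its usual product and the coproduct $\Delta x^n=\sum_{k=0}^n\binom{n}{k}x^{n-k}\otimes x^k$, let $\mu\in H^*$ be given by $\mu(x^n)=\mathbb{E}(X^n)$, let $\mu^{-1}$ be its inverse for the convolution product $\star$, and let $W:=\mu^{-1}\star\mathrm{id}:H\to H$. Then the linear operator $W$ has a composition inverse $W^{-1}:H\to H$, given by $W^{-1}=\mu\star\mathrm{id}$. Define, for $n,m\ge 0$, $$x^n\cdot_\mu x^m:=W\big(W^{-1}(x^n)\cdot W^{-1}(x^m)\big),$$ extended bilinearly, and $$\Delta_\mu:=(W\otimes W)\,\Delta\, W^{-1},\qquad \varepsilon_\mu:=\mu .$$ Then $H$ endowed with $\cdot_\mu$, $\Delta_\mu$ and $\varepsilon_\mu$ is a bicommutative (commutative and cocommutative) Hopf algebra, and $W$ is an isomorphism of Hopf algebras from $H$ with its original structure to $(H,\cdot_\mu,\Delta_\mu,\varepsilon_\mu)$. In particular, $$W(x^{n_1+\cdots+n_k})=W(x^{n_1})\cdot_\mu W(x^{n_2})\cdot_\mu\cdots\cdot_\mu W(x^{n_k})$$ for all $n_1,\dots,n_k\in\mathbb{N}$.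
   Context: $H=\mathbb{R}[x]$, with product $x^n\cdot x^m=x^{n+m}$, unit $1$, coproduct $\Delta:H\to H\otimes H$ given by $\Delta x^n=\sum_{k=0}^n\binom{n}{k}x^{n-k}\otimes x^k$ and counit $\varepsilon(x^n)=\mathbf 1_{(n=0)}$, is a connected graded commutative and cocommutative Hopf algebra. For $\alpha,\beta\in H^*$, $(\alpha\star\beta)(x^n):=(\alpha\otimes\beta)\Delta x^n$; for $\alpha\in H^*$ and a linear map $f:H\to H$, $\alpha\star f:=(\alpha\otimes f)\Delta:H\to H$ (using $\mathbb{R}\otimes H\cong H$). The set $\mathcal G(H):=\{\lambda\in H^*:\lambda(1)=1\}$ is a group for $\star$ with unit $\varepsilon$, and $\mu\in\mathcal G(H)$, so $\mu^{-1}$ is well defined. The unit of the deformed structure is again $1$. $\mathbb{N}=\{0,1,2,\dots\}$. *)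

(* Defs.v *)
From HB Require Import structures.
From mathcomp Require Import all_boot all_order all_algebra.
From mathcomp Require Import generic_quotient.
From mathcomp Require Import all_classical all_reals all_analysis.

Set Implicit Arguments.
Unset Strict Implicit.
Unset Printing Implicit Defensive.

Import Order.TTheory GRing.Theory Num.Theory.

Local Open Scope ring_scope.

(* MathComp has no tensor product of infinite-dimensional modules.  Here
   [tensor V W] is the type of formal finite sums of pairs, two sums being
   identified when no bilinear map tells them apart.  The universal property is
   [tens_bilinear], [tlift_tens], [tlift_linear] and [tensor_ext] below. *)

Definition is_bilinear (R : comNzRingType) (V W U : lmodType R)
    (B : V -> W -> U) : Prop :=
  (forall v, linear (B v)) /\ (forall w, linear (B^~ w)).

Definition bieval (R : comNzRingType) (V W U : lmodType R)
    (B : V -> W -> U) (s : seq (V * W)) : U :=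
  \sum_(p <- s) B p.1 p.2.

Definition tequiv (R : comNzRingType) (V W : lmodType R) : rel (seq (V * W)) :=
  fun s t => `[< forall (U : lmodType R) (B : V -> W -> U),
                   is_bilinear B -> bieval B s = bieval B t >].

Lemma tequiv_refl (R : comNzRingType) (V W : lmodType R) :
  reflexive (@tequiv R V W).
Proof. by move=> s; apply/asboolP. Qed.

Lemma tequiv_sym (R : comNzRingType) (V W : lmodType R) :
  symmetric (@tequiv R V W).
Proof.
by move=> s t; apply/asboolP/asboolP => h U B hB; rewrite (h U B hB).
Qed.

Lemma tequiv_trans (R : comNzRingType) (V W : lmodType R) :
  transitive (@tequiv R V W).
Proof.
move=> t s r /asboolP st /asboolP tr; apply/asboolP => U B hB.
by rewrite (st U B hB) (tr U B hB).
Qed.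

Canonical tequiv_equiv (R : comNzRingType) (V W : lmodType R) :=
  EquivRel (@tequiv R V W) (@tequiv_refl R V W) (@tequiv_sym R V W)
    (@tequiv_trans R V W).

Definition tensor (R : comNzRingType) (V W : lmodType R) : Type :=
  {eq_quot (@tequiv R V W)}%qT.

HB.instance Definition _ (R : comNzRingType) (V W : lmodType R) :=
  Choice.on (tensor V W).
HB.instance Definition _ (R : comNzRingType) (V W : lmodType R) :=
  EqQuotient.on (tensor V W).

(* Meaningful when [B] is bilinear: the linear map induced by [B]. *)
Definition tlift (R : comNzRingType) (V W U : lmodType R) (B : V -> W -> U)
    (t : tensor V W) : U := bieval B (repr t).

Definition tens (R : comNzRingType) (V W : lmodType R) (v : V) (w : W) :
  tensor V W := (\pi_(tensor V W) [:: (v, w)])%qT.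

Notation "v ⊗ w" := (tens v w) (at level 40, left associativity) : ring_scope.

Lemma tlift_pi (R : comNzRingType) (V W U : lmodType R) (B : V -> W -> U) s :
  is_bilinear B -> tlift B (\pi_(tensor V W) s)%qT = bieval B s.
Proof.
move=> hB; rewrite /tlift; case: piP => s' /eqmodP /asboolP h.
by rewrite -(h U B hB).
Qed.

Lemma tensor_eqP (R : comNzRingType) (V W : lmodType R) (s t : tensor V W) :
  (forall (U : lmodType R) (B : V -> W -> U), is_bilinear B ->
     tlift B s = tlift B t) -> s = t.
Proof.
move=> h; rewrite -[s]reprK -[t]reprK; apply/eqmodP/asboolP => U B hB.
exact: h.
Qed.

Definition tzero (R : comNzRingType) (V W : lmodType R) : tensor V W :=
  (\pi_(tensor V W) [::])%qT.

Definition tadd (R : comNzRingType) (V W : lmodType R) (s t : tensor V W) :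
  tensor V W := (\pi_(tensor V W) (repr s ++ repr t))%qT.

Definition tscale (R : comNzRingType) (V W : lmodType R) (a : R)
    (t : tensor V W) : tensor V W :=
  (\pi_(tensor V W) [seq (a *: p.1, p.2) | p <- repr t])%qT.

Lemma bilinearZl (R : comNzRingType) (V W U : lmodType R) (B : V -> W -> U) :
  is_bilinear B -> forall a v w, B (a *: v) w = a *: B v w.
Proof. by case=> _ hB a v w; exact: (scalable_linear (hB w)). Qed.

Lemma tlift0 (R : comNzRingType) (V W U : lmodType R) (B : V -> W -> U) :
  is_bilinear B -> tlift B (tzero V W) = 0.
Proof. by move=> hB; rewrite tlift_pi // /bieval big_nil. Qed.

Lemma tliftD (R : comNzRingType) (V W U : lmodType R) (B : V -> W -> U) :
  is_bilinear B -> forall s t, tlift B (tadd s t) = tlift B s + tlift B t.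
Proof. by move=> hB s t; rewrite tlift_pi // /bieval big_cat. Qed.

Lemma tliftZ (R : comNzRingType) (V W U : lmodType R) (B : V -> W -> U) :
  is_bilinear B -> forall a t, tlift B (tscale a t) = a *: tlift B t.
Proof.
move=> hB a t; rewrite tlift_pi // /tlift /bieval big_map scaler_sumr.
by apply: eq_bigr => p _; rewrite bilinearZl.
Qed.

Lemma taddA (R : comNzRingType) (V W : lmodType R) : associative (@tadd R V W).
Proof. by move=> a b c; apply: tensor_eqP => U B hB; rewrite !tliftD ?addrA. Qed.

Lemma taddC (R : comNzRingType) (V W : lmodType R) : commutative (@tadd R V W).
Proof. by move=> a b; apply: tensor_eqP => U B hB; rewrite !tliftD // addrC. Qed.

Lemma tadd0 (R : comNzRingType) (V W : lmodType R) :
  left_id (tzero V W) (@tadd R V W).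
Proof.
by move=> a; apply: tensor_eqP => U B hB; rewrite tliftD // tlift0 // add0r.
Qed.

Lemma taddN (R : comNzRingType) (V W : lmodType R) :
  left_inverse (tzero V W) (tscale (-1)) (@tadd R V W).
Proof.
move=> a; apply: tensor_eqP => U B hB.
by rewrite tliftD // tliftZ // tlift0 // scaleN1r addNr.
Qed.

HB.instance Definition _ (R : comNzRingType) (V W : lmodType R) :=
  GRing.isZmodule.Build (tensor V W)
    (@taddA R V W) (@taddC R V W) (@tadd0 R V W) (@taddN R V W).

Lemma tscaleA (R : comNzRingType) (V W : lmodType R) a b (t : tensor V W) :
  tscale a (tscale b t) = tscale (a * b) t.
Proof. by apply: tensor_eqP => U B hB; rewrite !tliftZ // scalerA. Qed.

Lemma tscale1 (R : comNzRingType) (V W : lmodType R) :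
  left_id 1 (@tscale R V W).
Proof. by move=> t; apply: tensor_eqP => U B hB; rewrite tliftZ // scale1r. Qed.

Lemma tscaleDr (R : comNzRingType) (V W : lmodType R) :
  right_distributive (@tscale R V W) +%R.
Proof.
move=> a s t; apply: tensor_eqP => U B hB.
by rewrite tliftZ // !tliftD // !tliftZ // scalerDr.
Qed.

Lemma tscaleDl (R : comNzRingType) (V W : lmodType R) (t : tensor V W) :
  {morph (@tscale R V W)^~ t : a b / a + b}.
Proof.
move=> a b; apply: tensor_eqP => U B hB.
by rewrite tliftD // !tliftZ // scalerDl.
Qed.

HB.instance Definition _ (R : comNzRingType) (V W : lmodType R) :=
  GRing.Zmodule_isLmodule.Build R (tensor V W)
    (@tscaleA R V W) (@tscale1 R V W) (@tscaleDr R V W) (@tscaleDl R V W).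

Lemma tlift_linear (R : comNzRingType) (V W U : lmodType R) (B : V -> W -> U) :
  is_bilinear B -> linear (tlift B).
Proof. by move=> hB a s t; rewrite tliftD // tliftZ. Qed.

Lemma tlift_tens (R : comNzRingType) (V W U : lmodType R) (B : V -> W -> U) :
  is_bilinear B -> forall v w, tlift B (v ⊗ w) = B v w.
Proof. by move=> hB v w; rewrite tlift_pi // /bieval big_seq1. Qed.

Lemma tens_bilinear (R : comNzRingType) (V W : lmodType R) :
  is_bilinear (@tens R V W).
Proof.
split=> [v a w w'|w a v v']; apply: tensor_eqP => U B hB;
  rewrite tlift_linear // !tlift_tens //; [exact: hB.1 | exact: hB.2].
Qed.

Lemma tensor_sum (R : comNzRingType) (V W : lmodType R) (t : tensor V W) :
  t = \sum_(p <- repr t) p.1 ⊗ p.2.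
Proof.
apply: tensor_eqP => U B hB; rewrite {1}/tlift /bieval.
elim: (repr t) => [|p s IH]; first by rewrite !big_nil (tlift0 hB).
by rewrite !big_cons IH (tliftD hB) tlift_tens.
Qed.

Lemma tensor_ext (R : comNzRingType) (V W U : lmodType R)
    (f g : tensor V W -> U) :
  linear f -> linear g -> (forall v w, f (v ⊗ w) = g (v ⊗ w)) -> f =1 g.
Proof.
move=> hf hg h t; rewrite [t]tensor_sum.
have lin0 k : linear k -> k (0 : tensor V W) = 0 :> U.
  by move=> hk; rewrite -(scale0r (0 : tensor V W)) (scalable_linear hk) /= scale0r.
elim: (repr t) => [|p s IH]; first by rewrite !big_nil !lin0.
by rewrite !big_cons -[p.1 ⊗ p.2]scale1r hf hg h IH.
Qed.

Definition tmap (R : comNzRingType) (V W V' W' : lmodType R)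
    (f : V -> V') (g : W -> W') : tensor V W -> tensor V' W' :=
  tlift (fun v w => f v ⊗ g w).

Definition tswap (R : comNzRingType) (V W : lmodType R) :
  tensor V W -> tensor W V := tlift (fun v w => w ⊗ v).

Definition tassoc (R : comNzRingType) (V W U : lmodType R) :
    tensor (tensor V W) U -> tensor V (tensor W U) :=
  tlift (fun (t : tensor V W) (u : U) => tlift (fun v w => v ⊗ (w ⊗ u)) t).

(* The canonical isomorphisms R ⊗ V = V and V ⊗ R = V. *)
Definition tlunit (R : comNzRingType) (V : lmodType R) : tensor R^o V -> V :=
  tlift (fun (a : R^o) (v : V) => (a : R) *: v).

Definition trunit (R : comNzRingType) (V : lmodType R) : tensor V R^o -> V :=
  tlift (fun (v : V) (a : R^o) => (a : R) *: v).

(* The product of V ⊗ V: (a ⊗ b)(a' ⊗ b') = aa' ⊗ bb'. *)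
Definition tmul (R : comNzRingType) (V : lmodType R) (m : V -> V -> V)
    (s t : tensor V V) : tensor V V :=
  tlift (fun a b => tlift (fun a' b' => m a a' ⊗ m b b') t) s.

Record hopf_data (R : comNzRingType) (V : lmodType R) := HopfData {
  hmul : V -> V -> V;
  hone : V;
  hcomul : V -> tensor V V;
  hcounit : V -> R^o }.

Definition is_algebra (R : comNzRingType) (V : lmodType R)
    (A : hopf_data V) : Prop :=
  [/\ is_bilinear (hmul A), associative (hmul A),
      left_id (hone A) (hmul A) & right_id (hone A) (hmul A)].

Definition is_coalgebra (R : comNzRingType) (V : lmodType R)
    (A : hopf_data V) : Prop :=
  [/\ linear (hcomul A), linear (hcounit A),
      forall x, tassoc (tmap (hcomul A) id (hcomul A x))
                = tmap id (hcomul A) (hcomul A x),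
      forall x, tlunit (tmap (hcounit A) id (hcomul A x)) = x
    & forall x, trunit (tmap id (hcounit A) (hcomul A x)) = x].

Definition is_bialgebra (R : comNzRingType) (V : lmodType R)
    (A : hopf_data V) : Prop :=
  [/\ is_algebra A, is_coalgebra A,
      forall x y, hcomul A (hmul A x y)
                  = tmul (hmul A) (hcomul A x) (hcomul A y)
                  /\ hcounit A (hmul A x y) = hcounit A x * hcounit A y,
      hcomul A (hone A) = hone A ⊗ hone A
    & hcounit A (hone A) = 1].

Definition is_antipode (R : comNzRingType) (V : lmodType R)
    (A : hopf_data V) (S : V -> V) : Prop :=
  [/\ linear S,
      forall x, tlift (hmul A) (tmap S id (hcomul A x))
                = (hcounit A x : R) *: hone A
    & forall x, tlift (hmul A) (tmap id S (hcomul A x))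
                = (hcounit A x : R) *: hone A].

Definition is_hopf_algebra (R : comNzRingType) (V : lmodType R)
    (A : hopf_data V) : Prop :=
  is_bialgebra A /\ exists S : V -> V, is_antipode A S.

Definition is_bicommutative (R : comNzRingType) (V : lmodType R)
    (A : hopf_data V) : Prop :=
  commutative (hmul A) /\ forall x, tswap (hcomul A x) = hcomul A x.

(* Compatibility with antipodes is automatic for morphisms of bialgebras. *)
Definition is_hopf_iso (R : comNzRingType) (V V' : lmodType R)
    (A : hopf_data V) (A' : hopf_data V') (f : V -> V') : Prop :=
  [/\ is_hopf_algebra A, is_hopf_algebra A', linear f & bijective f] /\
  [/\ forall x y, f (hmul A x y) = hmul A' (f x) (f y),
      f (hone A) = hone A',
      forall x, hcomul A' (f x) = tmap f f (hcomul A x)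
    & forall x, hcounit A' (f x) = hcounit A x].

(* [convol A alpha f] is (alpha ⊗ f) Δ under R ⊗ U = U.  The case U = R is the
   convolution of two functionals, the case U = V the action on a linear map. *)
Definition convol (R : comNzRingType) (V U : lmodType R) (A : hopf_data V)
    (alpha : V -> R^o) (f : V -> U) (x : V) : U :=
  tlunit (tmap alpha f (hcomul A x)).

Definition conv_group (R : comNzRingType) (V : lmodType R) (A : hopf_data V) :
  set (V -> R^o) := [set lambda | linear lambda /\ lambda (hone A) = 1]%classic.

Definition is_conv_inverse (R : comNzRingType) (V : lmodType R)
    (A : hopf_data V) (lambda nu : V -> R^o) : Prop :=
  [/\ conv_group A nu, convol A lambda nu = hcounit A
    & convol A nu lambda = hcounit A].

(* Junk value (the counit) when [lambda] has no inverse. *)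
Definition conv_inv (R : comNzRingType) (V : lmodType R) (A : hopf_data V)
    (lambda : V -> R^o) : V -> R^o :=
  xget (hcounit A) [set nu | is_conv_inverse A lambda nu]%classic.

Definition linext (R : comNzRingType) (V : lmodType R) (f : nat -> V)
    (p : {poly R}) : V := \sum_(n < size p) p`_n *: f n.

Definition bilinext (R : comNzRingType) (V : lmodType R) (f : nat -> nat -> V)
    (p q : {poly R}) : V :=
  \sum_(n < size p) \sum_(m < size q) (p`_n * q`_m) *: f n m.

Definition poly_comul (R : comNzRingType) : {poly R} -> tensor {poly R} {poly R} :=
  linext (fun n => \sum_(k < n.+1) 'C(n, k)%:R *: ('X^(n - k) ⊗ 'X^k)).

Definition poly_counit (R : comNzRingType) : {poly R} -> R^o :=
  linext (fun n => (n == 0%N)%:R : R^o).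

Definition poly_hopf (R : comNzRingType) : hopf_data {poly R} :=
  HopfData *%R 1 (@poly_comul R) (@poly_counit R).

Definition finite_moments d (T : measurableType d) (R : realType)
    (P : probability T R) (X : {RV P >-> R}) : Prop :=
  forall n : nat, P.-integrable [set: T]%classic (fun w => (X w ^+ n)%:E).

Definition moment_functional d (T : measurableType d) (R : realType)
    (P : probability T R) (X : {RV P >-> R}) : {poly R} -> R^o :=
  linext (fun n => fine 'E_P[fun w => X w ^+ n] : R^o).

Definition wick (R : comNzRingType) (mu : {poly R} -> R^o) :
  {poly R} -> {poly R} := convol (poly_hopf R) (conv_inv (poly_hopf R) mu) id.

Definition wick_inv (R : comNzRingType) (mu : {poly R} -> R^o) :
  {poly R} -> {poly R} := convol (poly_hopf R) mu id.

Definition wick_mul (R : comNzRingType) (mu : {poly R} -> R^o) :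
    {poly R} -> {poly R} -> {poly R} :=
  bilinext (fun n m => wick mu (wick_inv mu 'X^n * wick_inv mu 'X^m)).

Definition wick_comul (R : comNzRingType) (mu : {poly R} -> R^o)
    (p : {poly R}) : tensor {poly R} {poly R} :=
  tmap (wick mu) (wick mu) (poly_comul (wick_inv mu p)).

Definition wick_hopf (R : comNzRingType) (mu : {poly R} -> R^o) :
  hopf_data {poly R} := HopfData (wick_mul mu) 1 (wick_comul mu) mu.

(* Main.v *)
Require Import Defs.
From HB Require Import structures.
From mathcomp Require Import all_boot all_order all_algebra.
From mathcomp Require Import all_classical all_reals all_analysis.

(* [W] and [mu * id] are mutually inverse because acting by functionals through
   the coproduct is associative and unital, so the deformed operations are those
   of R[x] transported along the bijection [W]; in particular
   [epsilon (mu * id) = mu * epsilon = mu] is the transported counit.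
   For R[x] itself, Pascal's rule says [Delta (x p) = (x ⊗ 1 + 1 ⊗ x) Delta p],
   and each axiom, being an equality of linear maps, follows by induction on
   powers of [x]. *)

Set Implicit Arguments.
Unset Strict Implicit.

Import GRing.Theory.
Local Open Scope ring_scope.

(** * Linear maps on tensor products *)

Section Tensor.
Context {R : comNzRingType}.
Implicit Types V W U : lmodType R.

(** The fields of [hopf_data] are bare functions. Rewriting with this equation replaces one by a
    bundled linear map, to which [linearD] and the linear structure on [tmap] apply. *)
Lemma linear_bundle {V W} {f : V -> W} : linear f ->
  exists F : {linear V -> W}, f = F.
Proof.
move=> hf; pose m := GRing.isLinear.Build R V W *:%R f hf.
by exists (HB.pack_for {linear V -> W} f m).
Qed.

Lemma tensDl V W (v v' : V) (w : W) : (v + v') ⊗ w = v ⊗ w + v' ⊗ w.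
Proof.
have [_ h] := tens_bilinear V W.
by have := h w 1 v v'; rewrite !scale1r.
Qed.

Lemma tensDr V W (v : V) (w w' : W) : v ⊗ (w + w') = v ⊗ w + v ⊗ w'.
Proof.
have [h _] := tens_bilinear V W.
by have := h v 1 w w'; rewrite !scale1r.
Qed.

Lemma tensZl V W a (v : V) (w : W) : (a *: v) ⊗ w = a *: (v ⊗ w).
Proof. by have [_ h] := tens_bilinear V W; exact: (scalable_linear (h w)). Qed.

Lemma tensZr V W a (v : V) (w : W) : v ⊗ (a *: w) = a *: (v ⊗ w).
Proof. by have [h _] := tens_bilinear V W; exact: (scalable_linear (h v)). Qed.

(** Scalars are absorbed into a factor and zero is itself the pure tensor [0 ⊗ 0], so pure tensors
    and sums are the only cases. *)
Lemma tensor_ind V W (Q : tensor V W -> Prop) :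
  (forall v w, Q (v ⊗ w)) -> (forall s t, Q s -> Q t -> Q (s + t)) ->
  forall t, Q t.
Proof.
move=> Qt QD t; rewrite [t]tensor_sum.
elim: (repr t) => [|p s IH]; last by rewrite big_cons; exact: QD.
by rewrite big_nil -(scale0r (0 ⊗ 0)) -tensZl.
Qed.

(** All the [B u] are evaluated on the same representative [repr t], so linearity in [u] holds term
    by term. It serves for the nested lifts in [tassoc] and [tmul]. *)
Lemma tlift_linear_param V W U U' (B : U' -> V -> W -> U) t :
  (forall v w, linear (fun u => B u v w)) -> linear (fun u => tlift (B u) t).
Proof.
move=> hB a u u'; rewrite /tlift /bieval scaler_sumr -big_split /=.
by apply: eq_bigr => p _; exact: hB.
Qed.

Lemma tmap_bilinear V W V' W' (f : {linear V -> V'}) (g : {linear W -> W'}) :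
  is_bilinear (fun v w => f v ⊗ g w).
Proof.
by split=> [v a w w'|w a v v']; rewrite linearP ?tensDl ?tensDr ?tensZl ?tensZr.
Qed.

Lemma tmap_tens V W V' W' (f : {linear V -> V'}) (g : {linear W -> W'}) v w :
  tmap f g (v ⊗ w) = f v ⊗ g w.
Proof. by rewrite /tmap tlift_tens//; exact: tmap_bilinear. Qed.

Lemma tmap_linear V W V' W' (f : {linear V -> V'}) (g : {linear W -> W'}) :
  linear (tmap f g).
Proof. exact/tlift_linear/tmap_bilinear. Qed.

HB.instance Definition _ V W V' W' (f : {linear V -> V'}) (g : {linear W -> W'})
  := GRing.isLinear.Build R (tensor V W) (tensor V' W') *:%R (tmap f g)
       (tmap_linear f g).

Lemma tswap_bilinear V W : is_bilinear (fun (v : V) (w : W) => w ⊗ v).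
Proof.
by split=> [v a w w'|w a v v']; rewrite ?tensDl ?tensDr ?tensZl ?tensZr.
Qed.

Lemma tswap_tens V W (v : V) (w : W) : tswap (v ⊗ w) = w ⊗ v.
Proof. by rewrite /tswap tlift_tens//; exact: tswap_bilinear. Qed.

HB.instance Definition _ V W :=
  GRing.isLinear.Build R (tensor V W) (tensor W V) *:%R (@tswap R V W)
    (tlift_linear (tswap_bilinear V W)).

Lemma tassoc_bilinear0 V W U (u : U) :
  is_bilinear (fun (v : V) (w : W) => v ⊗ (w ⊗ u)).
Proof.
by split=> [v a w w'|w a v v'];
  rewrite ?(tensDl, tensZl, tensDr, tensZr).
Qed.

Lemma tassoc_bilinear V W U : is_bilinear
  (fun (t : tensor V W) (u : U) => tlift (fun v w => v ⊗ (w ⊗ u)) t).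
Proof.
split=> [t|u]; last exact/tlift_linear/tassoc_bilinear0.
by apply: tlift_linear_param => v w a u u'; rewrite !(tensDr, tensZr).
Qed.

Lemma tassoc_tens V W U (v : V) (w : W) (u : U) :
  tassoc ((v ⊗ w) ⊗ u) = v ⊗ (w ⊗ u).
Proof.
rewrite /tassoc tlift_tens; last exact: tassoc_bilinear.
by rewrite tlift_tens//; exact: tassoc_bilinear0.
Qed.

HB.instance Definition _ V W U :=
  GRing.isLinear.Build R (tensor (tensor V W) U) (tensor V (tensor W U)) *:%R
    (@tassoc R V W U) (tlift_linear (tassoc_bilinear V W U)).

Lemma tlunit_bilinear V : is_bilinear (fun (a : R^o) (v : V) => (a : R) *: v).
Proof.
split=> [a b v w|v b a a']; first by rewrite scalerDr !scalerA mulrC.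
by rewrite scalerDl scalerA.
Qed.

Lemma tlunit_tens V (a : R^o) (v : V) : tlunit (a ⊗ v) = (a : R) *: v.
Proof. by rewrite /tlunit tlift_tens//; exact: tlunit_bilinear. Qed.

HB.instance Definition _ V :=
  GRing.isLinear.Build R (tensor R^o V) V *:%R (@tlunit R V)
    (tlift_linear (tlunit_bilinear V)).

Lemma trunit_bilinear V : is_bilinear (fun (v : V) (a : R^o) => (a : R) *: v).
Proof. by have [h h'] := tlunit_bilinear V; split. Qed.

Lemma trunit_tens V (v : V) (a : R^o) : trunit (v ⊗ a) = (a : R) *: v.
Proof. by rewrite /trunit tlift_tens//; exact: trunit_bilinear. Qed.

HB.instance Definition _ V :=
  GRing.isLinear.Build R (tensor V R^o) V *:%R (@trunit R V)
    (tlift_linear (trunit_bilinear V)).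

Section Tmul.
Context {V : lmodType R} {m : V -> V -> V}.
Context (hm : is_bilinear m).

Let m_linear v : linear (m v). Proof. exact: hm.1. Qed.
Let m_linearl v : linear (m^~ v). Proof. exact: hm.2. Qed.

Lemma tmul_bilinear0 a b :
  is_bilinear (fun a' b' => m a a' ⊗ m b b').
Proof.
by split=> [v c w w'|w c v v'];
  rewrite m_linear ?(tensDl, tensZl, tensDr, tensZr).
Qed.

Lemma tmul_bilinear t : is_bilinear
  (fun a b => tlift (fun a' b' => m a a' ⊗ m b b') t).
Proof.
split=> [v|v]; apply: tlift_linear_param => a b c w w';
  by rewrite (m_linearl _ c) ?(tensDl, tensZl, tensDr, tensZr).
Qed.

Lemma tmul_tens a b a' b' : tmul m (a ⊗ b) (a' ⊗ b') = m a a' ⊗ m b b'.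
Proof.
rewrite /tmul tlift_tens; last exact: tmul_bilinear.
by rewrite tlift_tens//; exact: tmul_bilinear0.
Qed.

Lemma tmulDl s s' t : tmul m (s + s') t = tmul m s t + tmul m s' t.
Proof. by rewrite /tmul (tliftD (tmul_bilinear t)). Qed.

(** The outer lift of [tmul] runs over the left argument. Linearity on the right is therefore proved
    by induction on [s]; for a pure [s] only the inner lift remains. *)
Lemma tmul_linearr s : linear (tmul m s).
Proof.
move=> c t t'; elim/tensor_ind: s => [a b|s s' IH IH']; last first.
  by rewrite !tmulDl IH IH' scalerDr addrACA.
rewrite /tmul !(tlift_tens (tmul_bilinear _)).
exact/tlift_linear/tmul_bilinear0.
Qed.

Lemma tmulDr s t t' : tmul m s (t + t') = tmul m s t + tmul m s t'.
Proof. by have := tmul_linearr s 1 t t'; rewrite !scale1r. Qed.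

End Tmul.

End Tensor.

(** * Transport of a Hopf structure along a linear bijection *)

Section Transport.
Context {R : comNzRingType} {V V' : lmodType R}.
Context (A : hopf_data V) (f : {linear V -> V'}) (g : {linear V' -> V}).
Context (fK : cancel f g) (gK : cancel g f).

Definition transport_hopf : hopf_data V' :=
  HopfData (fun x y => f (hmul A (g x) (g y))) (f (hone A))
    (fun x => tmap f f (hcomul A (g x))) (hcounit A \o g).

Local Notation A' := transport_hopf.

Lemma transport_bicommutative : is_bicommutative A -> is_bicommutative A'.
Proof.
move=> [mC cC]; split=> [x y|x] /=; first by rewrite mC.
rewrite -{2}cC; move: (hcomul A _) => t0.
elim/(@tensor_ind R): t0 => [v w|s t IHs IHt].
  by rewrite !(tmap_tens, tswap_tens).
by rewrite !linearD /= IHs IHt.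
Qed.

Lemma transport_algebra : is_algebra A -> is_algebra A'.
Proof.
move=> [mB mA m1 m1']; split=> /=.
- by split=> [x a y z|x a y z]; rewrite linearP ?mB.1 1?(mB.2 _ a) linearP.
- by move=> x y z; rewrite !fK mA.
- by move=> x; rewrite fK m1 gK.
- by move=> x; rewrite fK m1' gK.
Qed.

(** Each axiom is [f], or a tensor power of it, applied to the axiom of [A] at [g x]: inner
    occurrences of [g \o f] cancel, and induction on tensors moves [f] to the outside. *)
Lemma transport_coalgebra : is_coalgebra A -> is_coalgebra A'.
Proof.
case=> /linear_bundle[D hD] /linear_bundle[e he].
rewrite /is_coalgebra /= hD he => DA De De'.
pose D' : {linear V' -> tensor V' V'} := tmap f f \o D \o g.
pose e' : {linear V' -> R^o} := e \o g.
split.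
- exact: (linearP D').
- exact: (linearP e').
(* Writing [idfun] for [id] exposes a bundled linear map, so that [tmap] is recognised as linear. *)
- move=> x; change (tassoc (tmap D' idfun (D' x)) = tmap idfun D' (D' x)).
  have l t : tassoc (tmap D' idfun (tmap f f t)) =
             tmap f (tmap f f) (tassoc (tmap D idfun t)).
    elim/(@tensor_ind R): t => [v w|s t IHs IHt]; last first.
      by rewrite !linearD /= IHs IHt.
    rewrite !tmap_tens /= fK.
    move: (D v) => t0; elim/(@tensor_ind R): t0 => [v1 v2|s t IHs IHt].
      by rewrite !(tmap_tens, tassoc_tens) /= tmap_tens.
    by rewrite !(tensDl, linearD) /= IHs IHt.
  have r t : tmap idfun D' (tmap f f t) = tmap f (tmap f f) (tmap idfun D t).
    elim/(@tensor_ind R): t => [v w|s t IHs IHt]; last first.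
      by rewrite !linearD /= IHs IHt.
    by rewrite !tmap_tens /= fK.
  apply: etrans (l _) _; apply: etrans (esym (r _)).
  by congr (tmap _ _ _); exact: DA.
- move=> x; change (tlunit (tmap e' idfun (D' x)) = x).
  have l t : tlunit (tmap e' idfun (tmap f f t)) = f (tlunit (tmap e idfun t)).
    elim/(@tensor_ind R): t => [v w|s t IHs IHt]; last first.
      by rewrite !linearD /= IHs IHt.
    by rewrite !tmap_tens !tlunit_tens linearZ /= fK.
  by rewrite -[RHS]gK; apply: etrans (l _) _; congr (f _); exact: De.
- move=> x; change (trunit (tmap idfun e' (D' x)) = x).
  have l t : trunit (tmap idfun e' (tmap f f t)) = f (trunit (tmap idfun e t)).
    elim/(@tensor_ind R): t => [v w|s t IHs IHt]; last first.
      by rewrite !linearD /= IHs IHt.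
    by rewrite !tmap_tens !trunit_tens linearZ /= fK.
  by rewrite -[RHS]gK; apply: etrans (l _) _; congr (f _); exact: De'.
Qed.

Lemma transport_bialgebra : is_bialgebra A -> is_bialgebra A'.
Proof.
case=> aA cA mA cA1 eA1.
split; [exact: transport_algebra | exact: transport_coalgebra | |  |].
- move=> x y /=; rewrite !fK; have [-> ->] := mA (g x) (g y); split=> //.
  have [mB' _ _ _] := transport_algebra aA; have [mB _ _ _] := aA.
  (* Since [f] is multiplicative, so is [f ⊗ f]; by biadditivity of both products pure tensors
     suffice. *)
  suff l s t : tmap f f (tmul (hmul A) s t) =
    tmul (hmul A') (tmap f f s) (tmap f f t) by exact: l.
  elim/(@tensor_ind R): s => [a b|s s' IH IH']; last first.
    by rewrite !(tmulDl mB, linearD) /= (tmulDl mB') IH IH'.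
  elim/(@tensor_ind R): t => [a' b'|t t' IH IH']; last first.
    by rewrite !(tmulDr mB, linearD) /= (tmulDr mB') IH IH'.
  by rewrite (tmul_tens mB) !tmap_tens (tmul_tens mB') /= !fK.
- by rewrite /= fK cA1 tmap_tens.
- by rewrite /= fK eA1.
Qed.

Lemma transport_hopf_algebra : is_hopf_algebra A -> is_hopf_algebra A'.
Proof.
case=> bA [_ [/linear_bundle[S ->] Sl Sr]].
split; first exact: transport_bialgebra.
pose S' : {linear V' -> V'} := f \o S \o g.
have [[mB _ _ _] _ _ _ _] := bA.
have [[mB' _ _ _] _ _ _ _] := transport_bialgebra bA.
exists S'; split.
- exact: (linearP S').
- move=> x.
  change (tlift (hmul A') (tmap S' idfun (tmap f f (hcomul A (g x)))) =
    hcounit A (g x) *: f (hone A)).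
  have l t : tlift (hmul A') (tmap S' idfun (tmap f f t)) =
             f (tlift (hmul A) (tmap S idfun t)).
    elim/(@tensor_ind R): t => [v w|s t IHs IHt]; last first.
      by rewrite !linearD /= !(tliftD mB, tliftD mB') /= linearD IHs IHt.
    by rewrite !tmap_tens !(tlift_tens mB, tlift_tens mB') /= !fK.
  by rewrite -linearZ; apply: etrans (l _) _; congr (f _); exact: Sl.
- move=> x.
  change (tlift (hmul A') (tmap idfun S' (tmap f f (hcomul A (g x)))) =
    hcounit A (g x) *: f (hone A)).
  have l t : tlift (hmul A') (tmap idfun S' (tmap f f t)) =
             f (tlift (hmul A) (tmap idfun S t)).
    elim/(@tensor_ind R): t => [v w|s t IHs IHt]; last first.
      by rewrite !linearD /= !(tliftD mB, tliftD mB') /= linearD IHs IHt.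
    by rewrite !tmap_tens !(tlift_tens mB, tlift_tens mB') /= !fK.
  by rewrite -linearZ; apply: etrans (l _) _; congr (f _); exact: Sr.
Qed.

Lemma transport_iso : is_hopf_algebra A -> is_hopf_iso A A' f.
Proof.
move=> hA; split; split=> //=.
- exact: transport_hopf_algebra.
- exact: linearP.
- by exists g.
- by move=> x y; rewrite !fK.
- by move=> x; rewrite fK.
- by move=> x; rewrite fK.
Qed.

End Transport.

(** * The Hopf algebra of polynomials *)

Section PolyHopf.
Context {R : comNzRingType}.
Implicit Types (V : lmodType R) (p q : {poly R}).
Local Notation H := (poly_hopf R).

(** Coefficients past the size vanish. This allows several polynomials to be expanded over one
    common range. *)
Lemma linextE V (f : nat -> V) N p : (size p <= N)%N ->
  linext f p = \sum_(n < N) p`_n *: f n.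
Proof.
move=> pN; rewrite /linext (big_ord_widen _ (fun n => p`_n *: f n) pN).
rewrite big_mkcond; apply: eq_bigr => i _; case: ltnP => // ip.
by rewrite nth_default// scale0r.
Qed.

Lemma linext_linear V (f : nat -> V) : linear (linext f).
Proof.
move=> a p q; pose N := maxn (size (a *: p + q)) (maxn (size p) (size q)).
rewrite !(@linextE _ _ N) ?leq_max ?leqnn ?orbT//.
rewrite scaler_sumr -big_split; apply: eq_bigr => i _ /=.
by rewrite coefD coefZ scalerDl scalerA.
Qed.

HB.instance Definition _ V (f : nat -> V) :=
  GRing.isLinear.Build R {poly R} V *:%R (linext f) (linext_linear f).

Lemma linextXn V (f : nat -> V) n : linext f 'X^n = f n.
Proof.
rewrite (@linextE _ _ n.+1) ?size_polyXn// (bigD1 ord_max)//= big1 ?addr0.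
  by rewrite coefXn eqxx scale1r.
by move=> i; rewrite -val_eqE /= coefXn => /negPf->; rewrite scale0r.
Qed.

Lemma poly_linear_Xn V (F G : {linear {poly R} -> V}) :
  (forall n, F 'X^n = G 'X^n) -> F =1 G.
Proof.
move=> FG p; rewrite -[p]coefK poly_def !linear_sum.
by apply: eq_bigr => i _; rewrite !linearZ /= FG.
Qed.

(** With this form an identity of linear maps reduces to its value at 1 and to how both sides react
    to multiplication by ['X]. *)
Lemma poly_linear_ind V (F G : {linear {poly R} -> V}) : F 1 = G 1 ->
  (forall p, F p = G p -> F ('X * p) = G ('X * p)) -> F =1 G.
Proof.
move=> FG1 FGX; apply: poly_linear_Xn; elim=> [|n IH]; first by rewrite expr0.
by rewrite exprS FGX.
Qed.

HB.instance Definition _ := GRing.Linear.copy (@poly_comul R)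
  (linext (fun n => \sum_(k < n.+1) 'C(n, k)%:R *: ('X^(n - k) ⊗ 'X^k))).

HB.instance Definition _ := GRing.Linear.copy (@poly_counit R)
  (linext (fun n => (n == 0%N)%:R : R^o)).

(** Named so that it can carry a linear structure and enter [tmap] as a bundled map. *)
Definition mulX p : {poly R} := 'X * p.

Lemma mulX_linear : linear mulX.
Proof. by move=> a p q; rewrite /mulX mulrDr scalerAr. Qed.

HB.instance Definition _ :=
  GRing.isLinear.Build R {poly R} {poly R} *:%R mulX mulX_linear.

(* Multiplication by [x ⊗ 1 + 1 ⊗ x]; locked because [linearD] would otherwise
   unfold it to expose a sum. *)
Definition tmulX (t : tensor {poly R} {poly R}) : tensor {poly R} {poly R} :=
  locked (tmap mulX idfun t + tmap idfun mulX t).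

Lemma tmulX_linear : linear tmulX.
Proof. by move=> a s t; rewrite /tmulX -!lock !linearP /= scalerDr addrACA. Qed.

HB.instance Definition _ :=
  GRing.isLinear.Build R (tensor {poly R} {poly R}) (tensor {poly R} {poly R})
    *:%R tmulX tmulX_linear.

Lemma tmulX_tens p q : tmulX (p ⊗ q) = ('X * p) ⊗ q + p ⊗ ('X * q).
Proof. by rewrite /tmulX -lock !tmap_tens. Qed.

Lemma poly_comulXn n : @poly_comul R 'X^n =
  \sum_(k < n.+1) 'C(n, k)%:R *: ('X^(n - k) ⊗ 'X^k).
Proof. exact: linextXn. Qed.

Lemma poly_comul1 : @poly_comul R 1 = 1 ⊗ 1.
Proof. by rewrite -(expr0 'X) poly_comulXn big_ord1 bin0 scale1r. Qed.

Lemma poly_comulMX p : poly_comul ('X * p) = tmulX (poly_comul p).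
Proof.
pose F : {linear {poly R} -> tensor {poly R} {poly R}} := @poly_comul R \o mulX.
pose G : {linear {poly R} -> tensor {poly R} {poly R}} :=
  tmulX \o @poly_comul R.
apply: (@poly_linear_Xn _ F G _ p) => n.
rewrite /F /G /= /mulX -exprS !poly_comulXn linear_sum /=.
under [RHS]eq_bigr => k _.
  rewrite linearZ /= tmulX_tens -!exprS scalerDr -subSn ?leq_ord//; over.
rewrite big_split /= big_ord_recl /= !bin0 subn0.
(* Pascal's rule splits the shifted sum: the part with ['C(n, k)] is multiplication by ['X] in the
   right factor, the part with ['C(n, k.+1)] belongs to the left factor. *)
under eq_bigr => k _ do
  rewrite /bump /= add1n binS natrD scalerDl subSS.
rewrite big_split /= addrA; congr (_ + _).
(* The last term on the left carries ['C(n, n.+1)], which is zero; the first term on the right is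
   the isolated ['X^n.+1 ⊗ 1]. *)
rewrite [RHS]big_ord_recl [in LHS]big_ord_recr /= bin_small// scale0r addr0.
by rewrite bin0 subn0.
Qed.

Lemma poly_counitE p : poly_counit p = p`_0.
Proof.
(* One index beyond the size keeps the range nonempty even for [p = 0], so the constant term can be
   split off. *)
rewrite /poly_counit (@linextE _ _ (size p).+1)// big_ord_recl big1 ?addr0.
  exact: mulr1.
by move=> i _; rewrite scaler0.
Qed.

Lemma poly_mul_bilinear :
  is_bilinear ( *%R : {poly R} -> {poly R} -> {poly R}).
Proof.
split=> [p a q r|p a q r] /=; first by rewrite mulrDr scalerAr.
by rewrite mulrDl scalerAl.
Qed.

Lemma poly_algebra : is_algebra H.
Proof.
split; [exact: poly_mul_bilinear|exact: mulrA|exact: mul1r|exact: mulr1].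
Qed.

Lemma poly_coassoc p : tassoc (tmap (@poly_comul R) id (poly_comul p)) =
  tmap id (@poly_comul R) (poly_comul p).
Proof.
(* Multiplication by [x ⊗ 1 ⊗ 1 + 1 ⊗ x ⊗ 1 + 1 ⊗ 1 ⊗ x]. Both iterated coproducts turn
   multiplication by ['X] into [T]. *)
pose T (t : tensor {poly R} (tensor {poly R} {poly R})) :=
  tmap mulX idfun t + tmap idfun tmulX t.
have l t : tassoc (tmap (@poly_comul R) idfun (tmulX t)) =
           T (tassoc (tmap (@poly_comul R) idfun t)).
  elim/(@tensor_ind R): t => [v w|s t IHs IHt]; last first.
    by rewrite /T !linearD /= IHs IHt /T addrACA.
  rewrite tmulX_tens linearD /= !tmap_tens /= poly_comulMX.
  move: (poly_comul v) => u; elim/(@tensor_ind R): u => [v1 v2|s t IHs IHt].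
    rewrite tmulX_tens tensDl !linearD /= !tassoc_tens /T !tmap_tens /=.
    by rewrite tmulX_tens tensDr !addrA.
  rewrite !(linearD, tensDl) /= [LHS]addrACA.
  move: IHs IHt; rewrite !linearD /= => -> ->.
  by rewrite /T !linearD /= addrACA.
have r t : tmap idfun (@poly_comul R) (tmulX t) =
           T (tmap idfun (@poly_comul R) t).
  elim/(@tensor_ind R): t => [v w|s t IHs IHt]; last first.
    by rewrite /T !linearD /= IHs IHt /T addrACA.
  by rewrite tmulX_tens linearD /T /= !tmap_tens /= poly_comulMX.
pose F := (@tassoc R _ _ _ \o tmap (@poly_comul R) idfun \o @poly_comul R)
  : {linear _ -> _}.
pose G := (tmap idfun (@poly_comul R) \o @poly_comul R) : {linear _ -> _}.
apply: (@poly_linear_ind _ F G) => [|q]; rewrite /F /G /=.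
  by rewrite !poly_comul1 !tmap_tens /= poly_comul1 tassoc_tens.
by rewrite poly_comulMX l r => ->.
Qed.

(** The element [x ⊗ 1 + 1 ⊗ x] is symmetric, so the swap commutes with [tmulX]. *)
Lemma poly_cocomm p : tswap (poly_comul p) = poly_comul p.
Proof.
have l t : tswap (tmulX t) = tmulX (tswap t).
  elim/(@tensor_ind R): t => [v w|s t IHs IHt].
    by rewrite tmulX_tens linearD /= !tswap_tens tmulX_tens addrC.
  by rewrite !linearD /= IHs IHt.
pose F := (@tswap R _ _ \o @poly_comul R) : {linear _ -> _}.
apply: (@poly_linear_ind _ F (@poly_comul R)) => [|q]; rewrite /F /=.
  by rewrite !poly_comul1 tswap_tens.
by rewrite poly_comulMX l => ->.
Qed.

(** The counit kills multiples of ['X], so only the summand [1 ⊗ x] of [tmulX] survives. *)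
Lemma poly_counitl p : tlunit (tmap (@poly_counit R) id (poly_comul p)) = p.
Proof.
have l t : tlunit (tmap (@poly_counit R) idfun (tmulX t)) =
           'X * tlunit (tmap (@poly_counit R) idfun t).
  elim/(@tensor_ind R): t => [v w|s t IHs IHt]; last first.
    by rewrite !linearD /= IHs IHt mulrDr.
  rewrite tmulX_tens linearD /= !tmap_tens linearD /= !tlunit_tens.
  by rewrite !poly_counitE coefXM /= scale0r add0r scalerAr.
pose F := (@tlunit R _ \o tmap (@poly_counit R) idfun \o @poly_comul R)
  : {linear {poly R} -> {poly R}}.
apply: (@poly_linear_ind _ F idfun) => [|q]; rewrite /F /=.
  by rewrite poly_comul1 tmap_tens tlunit_tens /= poly_counitE coef1 scale1r.
by rewrite poly_comulMX l => ->.
Qed.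

Lemma poly_counitr p : trunit (tmap id (@poly_counit R) (poly_comul p)) = p.
Proof.
rewrite -[RHS]poly_counitl -[in LHS]poly_cocomm.
change (trunit (tmap idfun (@poly_counit R) (tswap (poly_comul p))) =
  tlunit (tmap (@poly_counit R) idfun (poly_comul p))).
move: (poly_comul p) => u; elim/(@tensor_ind R): u => [v w|s t IHs IHt].
  by rewrite tswap_tens !tmap_tens trunit_tens tlunit_tens.
by rewrite !linearD /= IHs IHt.
Qed.

Lemma poly_coalgebra : is_coalgebra H.
Proof.
split; [exact: linearP|exact: linearP|exact: poly_coassoc|exact: poly_counitl|].
exact: poly_counitr.
Qed.

(** [tmulX] is multiplication by a fixed element, so it moves out of the left argument of the tensor
    product algebra by associativity. *)
Lemma poly_comulM p q :
  poly_comul (p * q) = @tmul R {poly R} *%R (poly_comul p) (poly_comul q).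
Proof.
have mB := @poly_mul_bilinear.
have l s t : @tmul R {poly R} *%R (tmulX s) t =
             tmulX (@tmul R {poly R} *%R s t).
  elim/(@tensor_ind R): s => [v w|s s' IHs IHt]; last first.
    by rewrite linearD /= !(tmulDl mB) IHs IHt linearD.
  rewrite tmulX_tens (tmulDl mB).
  elim/(@tensor_ind R): t => [v' w'|t t' IHs IHt]; last first.
    by rewrite !(tmulDr mB) addrACA IHs IHt linearD.
  by rewrite !(tmul_tens mB) tmulX_tens /= !mulrA.
(* Both sides are linear in [p], so powers of ['X] suffice; [F'] and [G'] below are the two sides as
   bundled maps. *)
suff h n : poly_comul ('X^n * q) =
           @tmul R {poly R} *%R (poly_comul 'X^n) (poly_comul q).
  have /linear_bundle[G hG] := tlift_linear (tmul_bilinear mB (poly_comul q)).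
  pose F := (@poly_comul R \o ( *%R^~ q)) : {poly R} -> _.
  have /linear_bundle[F' hF] : linear F.
    by move=> a u v; rewrite /F /= mulrDl -scalerAl linearP.
  pose G' := (G \o @poly_comul R) : {linear _ -> _}.
  transitivity (F' p); first by rewrite -hF.
  rewrite (@poly_linear_Xn _ F' G')=> [|n]; first by rewrite /G' /= -hG.
  by rewrite /G' /= -hG -hF /F /= h.
elim: n => [|n IH]; last by rewrite exprS -mulrA !poly_comulMX IH l.
rewrite expr0 mul1r poly_comul1; move: (poly_comul q) => u.
elim/(@tensor_ind R): u => [v w|s t IHs IHt].
  by rewrite (tmul_tens mB) !mul1r.
by rewrite (tmulDr mB) -IHs -IHt.
Qed.

Lemma poly_bialgebra : is_bialgebra H.
Proof.
split; [exact: poly_algebra|exact: poly_coalgebra| |exact: poly_comul1|].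
- by move=> p q; split; [exact: poly_comulM|rewrite /= !poly_counitE coef0M].
- by rewrite /= poly_counitE coef1.
Qed.

(** The generator [x] is primitive, so the antipode must send it to [-x]. The two terms of [tmulX]
    then cancel after multiplication, and the counit also vanishes on multiples of ['X], which
    leaves only the value at 1. *)
Lemma poly_antipode : is_antipode H (comp_poly (- 'X)).
Proof.
have mB := @poly_mul_bilinear.
pose S : {linear {poly R} -> {poly R}} := comp_poly (- 'X).
have SX p : S ('X * p) = - ('X * S p).
  by rewrite /S /= comp_polyM comp_polyX mulNr.
have S1 : S 1 = 1 by rewrite /S /= comp_polyC.
have l t : @tlift R {poly R} {poly R} {poly R} *%R (tmap S idfun (tmulX t)) = 0.
  elim/(@tensor_ind R): t => [v w|s t IHs IHt]; last first.
    by rewrite !linearD /= (tliftD mB) IHs IHt addr0.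
  rewrite tmulX_tens linearD /= !tmap_tens (tliftD mB) !(tlift_tens mB) /=.
  by rewrite -/(S _) SX mulrCA mulNr mulrA addNr.
have r t : @tlift R {poly R} {poly R} {poly R} *%R (tmap idfun S (tmulX t)) = 0.
  elim/(@tensor_ind R): t => [v w|s t IHs IHt]; last first.
    by rewrite !linearD /= (tliftD mB) IHs IHt addr0.
  rewrite tmulX_tens linearD /= !tmap_tens (tliftD mB) !(tlift_tens mB) /=.
  by rewrite -/(S _) SX mulrN mulrCA mulrA subrr.
have /linear_bundle[L hL] := tlift_linear mB.
pose E := ((fun a : R^o => (a : R) *: (1 : {poly R})) \o @poly_counit R).
have /linear_bundle[E' hE] : linear E.
  by move=> a p q; rewrite /E /= linearP scalerDl scalerA.
split; first exact: linearP.
- pose F := (L \o tmap S idfun \o @poly_comul R) : {linear _ -> _}.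
  move=> p; transitivity (F p); first by rewrite /F /= -hL.
  transitivity (E' p); last by rewrite -hE.
  apply: (@poly_linear_ind _ F E') => [|q _]; rewrite /F /= -hE -hL /E /=.
    rewrite poly_comul1 tmap_tens (tlift_tens mB) S1 poly_counitE coef1.
    by rewrite mul1r scale1r.
  by rewrite poly_comulMX l poly_counitE coefXM scale0r.
- pose F := (L \o tmap idfun S \o @poly_comul R) : {linear _ -> _}.
  move=> p; transitivity (F p); first by rewrite /F /= -hL.
  transitivity (E' p); last by rewrite -hE.
  apply: (@poly_linear_ind _ F E') => [|q _]; rewrite /F /= -hE -hL /E /=.
    rewrite poly_comul1 tmap_tens (tlift_tens mB) S1 poly_counitE coef1.
    by rewrite mul1r scale1r.
  by rewrite poly_comulMX r poly_counitE coefXM scale0r.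
Qed.

Lemma poly_hopf_algebra : is_hopf_algebra H.
Proof. split; [exact: poly_bialgebra|by eexists; exact: poly_antipode]. Qed.

Lemma poly_bicommutative : is_bicommutative H.
Proof. by split; [exact: mulrC|exact: poly_cocomm]. Qed.

End PolyHopf.

(** * Action of functionals by convolution *)

Section Convolution.
Context {R : comNzRingType} {V : lmodType R} (A : hopf_data V).
Context (cA : is_coalgebra A).
Implicit Types (U : lmodType R) (a b : {linear V -> R^o}).

Lemma convol_linear U a (f : {linear V -> U}) : linear (convol A a f).
Proof.
by have [cl _ _ _ _] := cA => c x y; rewrite /convol cl !linearP.
Qed.

(** This turns a composite of two convolution operators into an iterated action, ready for
    [convolA]. *)
Lemma convol_comp U U' (g : {linear U -> U'}) a (f : {linear V -> U}) x :
  g (convol A a f x) = convol A a (g \o f) x.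
Proof.
rewrite /convol; move: (hcomul A x) => t.
elim/(@tensor_ind R): t => [v w|s t IHs IHt].
  by rewrite !tmap_tens !tlunit_tens linearZ.
by rewrite !linearD /= IHs IHt.
Qed.

(** Both sides evaluate [a ⊗ b ⊗ f] on an iterated coproduct, and coassociativity identifies the
    two. In the proof [abf] is [b ⊗ f] acting on the last two factors. *)
Lemma convolA U a b (f : {linear V -> U}) x :
  convol A (convol A a b) f x = convol A a (convol A b f) x.
Proof.
have [/linear_bundle[D hD] _ cAA _ _] := cA; rewrite /convol hD.
pose ab : {linear V -> R^o} := @tlunit R R^o \o tmap a b \o D.
pose bf : {linear V -> U} := @tlunit R U \o tmap b f \o D.
pose abf : {linear tensor V V -> U} := @tlunit R U \o tmap b f.
change (tlunit (tmap ab f (D x)) = tlunit (tmap a bf (D x))).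
have l t : tlunit (tmap ab f t) =
           tlunit (tmap a abf (tassoc (tmap D idfun t))).
  elim/(@tensor_ind R): t => [v w|s t IHs IHt]; last first.
    by rewrite !linearD /= IHs IHt.
  rewrite !tmap_tens /ab /=.
  move: (D v) => u; elim/(@tensor_ind R): u => [v1 v2|s t IHs IHt]; last first.
    by rewrite !(linearD, tensDl) /= IHs IHt.
  rewrite tassoc_tens !tmap_tens /= !tlunit_tens tmap_tens !tlunit_tens.
  by rewrite scalerA.
have r t : tlunit (tmap a bf t) = tlunit (tmap a abf (tmap idfun D t)).
  elim/(@tensor_ind R): t => [v w|s t IHs IHt]; last first.
    by rewrite !linearD /= IHs IHt.
  by rewrite !tmap_tens.
rewrite l r; congr (tlunit (tmap _ _ _)).
by have := cAA x; rewrite hD.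
Qed.

Lemma convol_counitl U (f : {linear V -> U}) x : convol A (hcounit A) f x = f x.
Proof.
have [_ /linear_bundle[e he] _ eA _] := cA; rewrite /convol he.
rewrite -[in RHS](eA x) he.
change (tlunit (tmap e f (hcomul A x)) =
  f (tlunit (tmap e idfun (hcomul A x)))).
exact: (esym (convol_comp f e idfun x)).
Qed.

Lemma convolC a b x : (forall y, tswap (hcomul A y) = hcomul A y) ->
  convol A a b x = convol A b a x.
Proof.
move=> cC; rewrite /convol -[in LHS]cC.
move: (hcomul A x) => t; elim/(@tensor_ind R): t => [v w|s t IHs IHt].
  by rewrite tswap_tens !tmap_tens !tlunit_tens; exact: mulrC.
by rewrite !linearD /= IHs IHt.
Qed.

End Convolution.

(** * Convolution inverses of functionals on polynomials *)

Section PolyConvolution.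
Context {R : comNzRingType}.
Local Notation H := (poly_hopf R).

Lemma poly_convolXn (U : lmodType R) (a : {linear {poly R} -> R^o})
    (f : {linear {poly R} -> U}) n :
  convol H a f 'X^n =
  \sum_(k < n.+1) ('C(n, k)%:R * a 'X^(n - k)) *: f 'X^k.
Proof.
rewrite /convol /= poly_comulXn (linear_sum (tmap a f)) /=.
rewrite (linear_sum (@tlunit R U)) /=; apply: eq_bigr => k _.
by rewrite !linearZ /= tmap_tens tlunit_tens scalerA.
Qed.

Lemma poly_convol1 (U : lmodType R) (a : {linear {poly R} -> R^o})
    (f : {linear {poly R} -> U}) : convol H a f 1 = (a 1 : R) *: f 1.
Proof. by rewrite /convol /= poly_comul1 tmap_tens tlunit_tens. Qed.

(* [mu * nu = epsilon] at [x^n] determines [nu (x^n)] from the [nu (x^k)],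
   [k < n]. *)
Fixpoint inv_moments (m : nat -> R) (n : nat) : seq R :=
  if n is n'.+1 then
    let s := inv_moments m n' in
    rcons s ((n' == 0)%:R - \sum_(k < n') 'C(n', k)%:R * m (n' - k)%N * s`_k)
  else [::].

Definition inv_moment m n := (inv_moments m n.+1)`_n.

Lemma size_inv_moments m n : size (inv_moments m n) = n.
Proof. by elim: n => //= n IH; rewrite size_rcons IH. Qed.

(** Entries never change once appended, so the recursion may be read on single values. *)
Lemma nth_inv_moments m n k : (k < n)%N ->
  (inv_moments m n)`_k = inv_moment m k.
Proof.
elim: n => // n IH; rewrite ltnS leq_eqVlt => /predU1P[->//|kn].
by rewrite /= nth_rcons size_inv_moments kn IH.
Qed.

Lemma inv_momentE m n : inv_moment m n =
  (n == 0)%:R - \sum_(k < n) 'C(n, k)%:R * m (n - k)%N * inv_moment m k.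
Proof.
rewrite {1}/inv_moment /= nth_rcons size_inv_moments ltnn eqxx.
by congr (_ - _); apply: eq_bigr => k _; rewrite nth_inv_moments.
Qed.

(** Because [mu 1 = 1], the equation at ['X^n] is solved for [nu 'X^n] without division.
    Cocommutativity makes this right inverse two-sided. *)
Lemma conv_group_inverse (mu : {linear {poly R} -> R^o}) :
  conv_group H mu -> exists nu, is_conv_inverse H mu nu.
Proof.
move=> [_ /= mu1].
pose nu := linext (inv_moment (fun n => mu 'X^n) : nat -> R^o).
have muC x : convol H mu nu x = convol H nu mu x.
  by apply: convolC; exact: poly_cocomm.
have munu x : convol H mu nu x = poly_counit x.
  have /linear_bundle[F hF] := convol_linear poly_coalgebra mu nu.
  rewrite hF; move: x; apply: poly_linear_Xn => n.
  rewrite -hF poly_convolXn big_ord_recr /= subnn expr0 mu1 binn mulr1 scale1r.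
  under eq_bigr do rewrite linextXn.
  by rewrite /nu /poly_counit !linextXn inv_momentE [LHS]addrC subrK.
exists nu; split; first split=> /=.
- exact: linearP.
- by have := munu 1; rewrite poly_convol1 mu1 scale1r poly_counitE coef1.
- exact/funext.
- by apply/funext => x; rewrite -muC munu.
Qed.

(** Existence of an inverse excludes the default value of [xget]. *)
Lemma conv_invP (mu : {linear {poly R} -> R^o}) :
  conv_group H mu -> is_conv_inverse H mu (conv_inv H mu).
Proof.
move=> /conv_group_inverse[nu hnu]; rewrite /conv_inv; case: xgetP => //.
by move=> /(_ nu) /(_ hnu).
Qed.

End PolyConvolution.

(** * The operator [W] and the deformed structure *)

Section Wick.
Context {R : comNzRingType} (mu : {linear {poly R} -> R^o}).
Local Notation H := (poly_hopf R).
Context (hmu : conv_group H mu).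

Lemma wick_linear : linear (wick mu).
Proof.
have [[/linear_bundle[nu hnu] _] _ _] := conv_invP hmu.
rewrite /wick hnu; exact: (convol_linear poly_coalgebra nu idfun).
Qed.

Lemma wick_inv_linear : linear (wick_inv mu).
Proof. exact: (convol_linear poly_coalgebra mu idfun). Qed.

Lemma wickK : cancel (wick mu) (wick_inv mu).
Proof.
have /linear_bundle[F hF] := wick_inv_linear.
have [[/linear_bundle[nu hnu] _] _ numu] := conv_invP hmu.
move=> p; rewrite hF /wick hnu.
(* [W^-1 (W p)] becomes [nu ⋆ (mu ⋆ id)] at [p], which is then reassociated to [(nu ⋆ mu) ⋆ id]. *)
apply: etrans (convol_comp H F nu idfun p) _; rewrite -hF.
apply: etrans (esym (convolA poly_coalgebra nu mu idfun p)) _.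
by rewrite -hnu numu; exact: (convol_counitl poly_coalgebra idfun).
Qed.

Lemma wick_invK : cancel (wick_inv mu) (wick mu).
Proof.
have /linear_bundle[F hF] := wick_linear.
have [[/linear_bundle[nu hnu] _] munu _] := conv_invP hmu.
move=> p; rewrite hF /wick_inv.
apply: etrans (convol_comp H F mu idfun p) _; rewrite -hF /wick hnu.
apply: etrans (esym (convolA poly_coalgebra mu nu idfun p)) _.
by rewrite -hnu munu; exact: (convol_counitl poly_coalgebra idfun).
Qed.

Lemma wick1 : wick mu 1 = 1.
Proof.
have [[/linear_bundle[nu hnu] nu1] _ _] := conv_invP hmu.
rewrite /wick hnu; apply: etrans (poly_convol1 nu idfun) _.
by rewrite -hnu [X in X *: _]nu1 scale1r.
Qed.

Lemma poly_counit_wick_inv p : poly_counit (wick_inv mu p) = mu p.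
Proof.
apply: etrans (convol_comp H (@poly_counit R) mu idfun p) _.
apply: etrans (convolC (A := H) mu (@poly_counit R) p (@poly_cocomm R)) _.
exact: (convol_counitl poly_coalgebra mu).
Qed.

(** The deformed product is given on monomials only; bilinearity of the right-hand side extends the
    formula to all polynomials. *)
Lemma wick_mulE p q : wick_mul mu p q = wick mu (wick_inv mu p * wick_inv mu q).
Proof.
have /linear_bundle[F hF] := wick_linear.
have /linear_bundle[G hG] := wick_inv_linear.
rewrite /wick_mul /bilinext hF hG.
rewrite -[in RHS](coefK p) -[in RHS](coefK q) !poly_def !linear_sum /=.
rewrite mulr_suml linear_sum; apply: eq_bigr => i _.
rewrite mulr_sumr linear_sum; apply: eq_bigr => j _.
by rewrite !linearZ /= -scalerAl -scalerAr scalerA linearZ.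
Qed.

(** An equality of records, through which every transport lemma applies by rewriting; [F] and [G]
    are [W] and its inverse in bundled form. *)
Lemma wick_hopfE (F G : {linear {poly R} -> {poly R}}) :
  wick mu = F -> wick_inv mu = G -> wick_hopf mu = transport_hopf H F G.
Proof.
move=> hF hG; rewrite /wick_hopf /transport_hopf /=; congr HopfData.
- by apply/funext => p; apply/funext => q; rewrite wick_mulE hF hG.
- by rewrite -hF wick1.
- by apply/funext => p; rewrite /wick_comul hF hG.
- by apply/funext => p /=; rewrite -hG poly_counit_wick_inv.
Qed.

Lemma wick_hopf_algebra :
  is_hopf_algebra (wick_hopf mu) /\ is_bicommutative (wick_hopf mu).
Proof.
have /linear_bundle[F hF] := wick_linear.
have /linear_bundle[G hG] := wick_inv_linear.
have FK : cancel F G by rewrite -hF -hG; exact: wickK.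
have GK : cancel G F by rewrite -hF -hG; exact: wick_invK.
rewrite (wick_hopfE hF hG); split.
  exact: transport_hopf_algebra poly_hopf_algebra.
exact: transport_bicommutative poly_bicommutative.
Qed.

Lemma wick_hopf_iso : is_hopf_iso H (wick_hopf mu) (wick mu).
Proof.
have /linear_bundle[F hF] := wick_linear.
have /linear_bundle[G hG] := wick_inv_linear.
have FK : cancel F G by rewrite -hF -hG; exact: wickK.
have GK : cancel G F by rewrite -hF -hG; exact: wick_invK.
by rewrite (wick_hopfE hF hG) hF; exact: transport_iso poly_hopf_algebra.
Qed.

Lemma wickX_sum (k : nat) (n : 'I_k -> nat) :
  wick mu 'X^(\sum_(i < k) n i) = \big[wick_mul mu/1]_(i < k) wick mu 'X^(n i).
Proof.
elim: k n => [|k IH] n; first by rewrite !big_ord0 expr0 wick1.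
(* The iterated product is bracketed to the right, so the first factor is peeled off. *)
by rewrite !big_ord_recl exprD -IH wick_mulE !wickK.
Qed.

End Wick.

(** The value at 1 is the expectation of the constant 1, that is the total mass of [P]. *)
Lemma moment_functional_group d (T : measurableType d) (R : realType)
    (P : probability T R) (X : {RV P >-> R}) :
  conv_group (poly_hopf R) (moment_functional X).
Proof.
split; first exact: linext_linear.
rewrite /moment_functional /= -(expr0 'X) linextXn.
under [X in expectation _ X]funext do rewrite expr0.
by rewrite expectation_cst.
Qed.

Theorem theorem1p2 (d : measure_display) (T : measurableType d) (R : realType)
    (P : probability T R) (X : {RV P >-> R}) (hX : finite_moments X) :
  let H := poly_hopf R in
  let mu := moment_functional X in
  let W := wick mu in
  [/\ conv_group H mu /\ is_conv_inverse H mu (conv_inv H mu),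
      cancel W (convol H mu id) /\ cancel (convol H mu id) W,
      is_hopf_algebra (wick_hopf mu) /\ is_bicommutative (wick_hopf mu),
      is_hopf_iso H (wick_hopf mu) W
    & forall (k : nat) (n : 'I_k -> nat),
        W 'X^(\sum_(i < k) n i)
        = \big[wick_mul mu/1]_(i < k) W 'X^(n i)].
Proof.
move=> H mu W; have hmu := moment_functional_group X.
have /linear_bundle[m hm] := hmu.1.
rewrite {}/W {}/mu {}/H; move: hmu; rewrite hm => hmu.
split.
- by split=> //; exact: conv_invP.
- by split; [exact: wickK|exact: wick_invK].
- exact: wick_hopf_algebra.
- exact: wick_hopf_iso.
- exact: wickX_sum.
Qed.
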